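(* Let $\mathbf{P}\subset\mathbb{C}$ be a Jordan arc and let $A\colon\mathbf{P}\to\mathbb{C}^{n\times n}$ and $b\colon\mathbf{P}\to\mathbb{C}^{n}$ be continuous such that $(A(\theta),b(\theta))$ is reachable for every $\theta\in\mathbf{P}$ (i.e. $\operatorname{rank}(b(\theta),A(\theta)b(\theta),\dots,A(\theta)^{n-1}b(\theta))=n$). Then there exists a continuous row vector $f\colon\mathbf{P}\to\mathbb{C}^{1\times n}$ such that the pair $(A+bf,b)$ is uniformly ensemble reachable.
   Context: A Jordan arc is the image of a continuous injective map from a compact interval into $\mathbb{C}$. For continuous $A\colon\mathbf{P}\to\mathbb{C}^{n\times n}$, $B\colon\mathbf{P}\to\mathbb{C}^{n\times m}$, the pair $(A,B)$ is uniformly ensemble reachable (from zero) if for every continuous $f\colon\mathbf{P}\to\mathbb{C}^n$ and every $\varepsilon>0$ there exist $T>0$ and an input $u$ such that $\sup_{\theta\in\mathbf{P}}\|\varphi(T,0,u)(\theta)-f(\theta)\|<\varepsilon$. Here, for the continuous-time system $\partial_t x(t,\theta)=A(\theta)x(t,\theta)+B(\theta)u(t)$, $x(0,\theta)=0$, one takes $u\in L^1([0,T],\mathbb{C}^m)$ and $\varphi(T,0,u)(\theta)=\int_0^T e^{A(\theta)(T-s)}B(\theta)u(s)\,ds$; for the discrete-time system $x_{t+1}(\theta)=A(\theta)x_t(\theta)+B(\theta)u_t$, $x_0(\theta)=0$, one takes $T\in\mathbb{N}$, $u=(u_0,\dots,u_{T-1})$, $u_i\in\mathbb{C}^m$, and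 $\varphi(T,0,u)(\theta)=\sum_{k=0}^{T-1}A(\theta)^kB(\theta)u_{T-1-k}$. The result holds for either notion. The input $u$ is independent of $\theta$. *)

(* Defs.v *)
From HB Require Import structures.
From mathcomp Require Import all_boot all_order all_algebra.
From mathcomp Require Import complex.
From mathcomp Require Import all_classical all_reals all_analysis.
Import numFieldTopology.Exports numFieldNormedType.Exports.

Set Implicit Arguments.
Unset Strict Implicit.
Unset Printing Implicit Defensive.
Import Order.TTheory GRing.Theory Num.Theory.
Local Open Scope ring_scope.
Local Open Scope complex_scope.
Local Open Scope classical_set_scope.

(* The standard (modulus-)metric topology on C = R[i], i.e. the one the library
   gives to every numFieldType  K  through  K^o.  (HB does not infer the generic
   instance for the concrete type R[i], so we declare the copy explicitly.) *)
HB.instance Definition _ (R : realType) := PseudoPointedMetric.copy R[i] R[i]^o.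

Definition jordan_arc (R : realType) (P : set R[i]) : Prop :=
  exists (a b : R) (g : R -> R[i]),
    a < b /\ {within `[a, b], continuous g} /\
    {in `[a, b] &, injective g} /\ P = g @` `[a, b].

Definition kalman_reachable (R : realType) (n : nat)
    (A : 'M[R[i]]_n) (b : 'cV[R[i]]_n) : Prop :=
  \rank (\matrix_(i < n, j < n) (A ^+ j *m b) i ord0) = n.

Definition dt_endpoint (R : realType) (n m : nat) (A : 'M[R[i]]_n)
    (B : 'M[R[i]]_(n, m)) (T : nat) (u : nat -> 'cV[R[i]]_m) : 'cV[R[i]]_n :=
  \sum_(k < T) (A ^+ k *m B *m u (T.-1 - k)%N).

(* sup_{theta in P} || phi - f theta || < eps, written literally as: some upper
   bound of the set of errors is < eps. *)
Definition dt_uniformly_ensemble_reachable (R : realType) (n m : nat)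
    (P : set R[i]) (A : R[i] -> 'M[R[i]]_n) (B : R[i] -> 'M[R[i]]_(n, m)) : Prop :=
  forall (f : R[i] -> 'cV[R[i]]_n), {within P, continuous f} ->
  forall eps : R, 0 < eps ->
  exists (T : nat) (u : nat -> 'cV[R[i]]_m),
  exists2 d : R, d < eps &
    forall th, P th -> `| dt_endpoint (A th) (B th) T u - f th | <= d%:C.

Definition expmx (R : realType) (n : nat) (M : 'M[R[i]]_n) : 'M[R[i]]_n :=
  limn (series (fun k : nat => (k`!%:R)^-1 *: M ^+ k)).

Definition cintegral (R : realType) (a b : R) (g : R -> R[i]) : R[i] :=
  (Rintegral (@lebesgue_measure R) `[a, b] (fun s => complex.Re (g s)))
  +i* (Rintegral (@lebesgue_measure R) `[a, b] (fun s => complex.Im (g s))).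

Definition L1_input (R : realType) (m : nat) (T : R) (u : R -> 'cV[R[i]]_m) : Prop :=
  forall i : 'I_m,
    (@lebesgue_measure R).-integrable `[0, T] (fun s => (complex.Re (u s i ord0))%:E) /\
    (@lebesgue_measure R).-integrable `[0, T] (fun s => (complex.Im (u s i ord0))%:E).

Definition ct_endpoint (R : realType) (n m : nat) (A : 'M[R[i]]_n)
    (B : 'M[R[i]]_(n, m)) (T : R) (u : R -> 'cV[R[i]]_m) : 'cV[R[i]]_n :=
  \col_(i < n) cintegral 0 T
     (fun s => (expmx ((T - s)%:C *: A) *m B *m u s) i ord0).

Definition ct_uniformly_ensemble_reachable (R : realType) (n m : nat)
    (P : set R[i]) (A : R[i] -> 'M[R[i]]_n) (B : R[i] -> 'M[R[i]]_(n, m)) : Prop :=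
  forall (f : R[i] -> 'cV[R[i]]_n), {within P, continuous f} ->
  forall eps : R, 0 < eps ->
  exists (T : R) (u : R -> 'cV[R[i]]_m), 0 < T /\ L1_input T u /\
  exists2 d : R, d < eps &
    forall th, P th -> `| ct_endpoint (A th) (B th) T u - f th | <= d%:C.

(* Main.v *)
Require Import Defs.
From HB Require Import structures.
From mathcomp Require Import all_boot all_order all_algebra.
From mathcomp Require Import complex.
From mathcomp Require Import all_classical all_reals all_analysis.
From mathcomp Require Import ring lra zify.
Import numFieldTopology.Exports numFieldNormedType.Exports.
Import Order.TTheory GRing.Theory Num.Theory.
Local Open Scope ring_scope.
Local Open Scope complex_scope.
Local Open Scope classical_set_scope.

Set Implicit Arguments.
Unset Strict Implicit.

(* With C = (b, Ab, ..., A^(n-1) b) and w the last row of C^-1, Ackermann's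
   formula F = - w (A - l_1) ... (A - l_n) gives A + bF any prescribed continuous
   eigenvalues l_1, ..., l_n; the rows w prod_(j != i) (A - l_j) are the left
   eigenvectors and take the value 1 on b.  In the basis they define, the reachable
   states are theta |-> (p(l_i(theta)))_i for polynomials p, so it is enough that
   the l_i sweep out pairwise disjoint real intervals as theta runs through the arc:
   approximating n continuous functions of theta is then a single application of
   the Weierstrass theorem on the real line.  In continuous time, inputs constant
   on the intervals [k, k+1] turn p(l_i) into p(e^l_i) (e^l_i - 1) / l_i, so one
   prescribes the e^l_i instead. *)

(** * Limits of matrices *)

Section MatrixLimits.
Context {K : numFieldType} {T : Type} (F : set_system T) {FF : Filter F}.

Lemma mx_norm_le (p q : nat) (M : 'M[K]_(p, q)) (d : K) :
  0 <= d -> (forall i j, `|M i j| <= d) -> `|M| <= d.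
Proof.
move=> d0 Md.
rewrite /Num.Def.normr /= mx_normE (_ : d = (NngNum d0)%:num) // num_le.
by apply/bigmax_leP; split=> [|[i j] _] //; rewrite -num_le /=; exact: Md.
Qed.

(** The matrix norm is the maximum of the moduli of the entries, and a filter is stable under finite
    intersections. [F] is kept arbitrary because limits are later taken along [nbhs t],
    [within P (nbhs z)] and [\oo]. *)
Lemma cvg_mxP (p q : nat) (f : T -> 'M[K]_(p, q)) (M : 'M[K]_(p, q)) :
  (f x @[x --> F] --> M) <-> (forall i j, f x i j @[x --> F] --> M i j).
Proof.
split=> [fM i j|fM].
  exact: (cvg_comp _ _ fM (@coord_continuous K p q i j M)).
apply/cvgrPdist_le => e e0.
have near_coord : \forall x \near F, forall i j, `|M i j - f x i j| <= e.
  apply: filter_forall => i; apply: filter_forall => j.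
  by move/cvgrPdist_le: (fM i j); apply.
apply: filterS near_coord => x Mx.
by apply: mx_norm_le (ltW e0) _ => i j; rewrite !mxE.
Qed.

Lemma cvg_bigsum (I : Type) (r : seq I) (f : I -> T -> K) (a : I -> K) :
  (forall i, f i x @[x --> F] --> a i) ->
  \sum_(i <- r) f i x @[x --> F] --> \sum_(i <- r) a i.
Proof.
move=> fa; elim: r => [|i r IH].
  by rewrite big_nil; under eq_cvg do rewrite big_nil; exact: cvg_cst.
by rewrite big_cons; under eq_cvg do rewrite big_cons; exact: cvgD.
Qed.

Lemma cvg_bigprod (I : Type) (r : seq I) (f : I -> T -> K) (a : I -> K) :
  (forall i, f i x @[x --> F] --> a i) ->
  \prod_(i <- r) f i x @[x --> F] --> \prod_(i <- r) a i.
Proof.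
move=> fa; elim: r => [|i r IH].
  by rewrite big_nil; under eq_cvg do rewrite big_nil; exact: cvg_cst.
by rewrite big_cons; under eq_cvg do rewrite big_cons; exact: cvgM.
Qed.

Lemma cvg_mulmx (p q r : nat) (f : T -> 'M[K]_(p, q)) (g : T -> 'M[K]_(q, r))
    (M : 'M[K]_(p, q)) (N : 'M[K]_(q, r)) :
  f x @[x --> F] --> M -> g x @[x --> F] --> N ->
  f x *m g x @[x --> F] --> M *m N.
Proof.
move=> /cvg_mxP fM /cvg_mxP gN; apply/cvg_mxP => i j.
rewrite mxE; under eq_cvg do rewrite mxE.
by apply: cvg_bigsum => k; exact: cvgM.
Qed.

Lemma cvg_det (p : nat) (f : T -> 'M[K]_p) (M : 'M[K]_p) :
  f x @[x --> F] --> M -> \det (f x) @[x --> F] --> \det M.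
Proof.
move=> /cvg_mxP fM; apply: cvg_bigsum => s.
by apply: cvgM; [exact: cvg_cst | exact: cvg_bigprod].
Qed.

(** Cramer's rule expresses the inverse through determinants. As [invmx] returns a singular matrix
    unchanged, invertibility near [F] is what identifies it with that formula. *)
Lemma cvg_invmx (p : nat) (f : T -> 'M[K]_p) (M : 'M[K]_p) :
  M \in unitmx -> (\forall x \near F, f x \in unitmx) ->
  f x @[x --> F] --> M -> invmx (f x) @[x --> F] --> invmx M.
Proof.
move=> uM uf fM.
suff adj_cvg : (\det (f x))^-1 *: \adj (f x) @[x --> F] -->
               (\det M)^-1 *: \adj M.
  rewrite /invmx uM; apply: cvg_trans adj_cvg.
  by apply: near_eq_cvg; apply: filterS uf => x ->.
apply/cvg_mxP => i j; rewrite !mxE; under eq_cvg do rewrite !mxE.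
apply: cvgM; first by apply: cvgV; [rewrite -unitfE -unitmxE | exact: cvg_det].
apply: cvgM; first exact: cvg_cst.
apply: cvg_det; apply/cvg_mxP => k l; rewrite !mxE.
under eq_cvg do rewrite !mxE.
by move/cvg_mxP: fM; apply.
Qed.

Lemma cvg_mx_exp (p : nat) (f : T -> 'M[K]_p) (M : 'M[K]_p) (k : nat) :
  f x @[x --> F] --> M -> f x ^+ k @[x --> F] --> M ^+ k.
Proof.
move=> fM; elim: k => [|k IH].
  by under eq_cvg do rewrite expr0; exact: cvg_cst.
by rewrite exprS; under eq_cvg do rewrite exprS; exact: cvg_mulmx.
Qed.

Lemma cvg_mx_prod (p : nat) (I : Type) (r : seq I) (Q : pred I)
    (f : I -> T -> 'M[K]_p) (M : I -> 'M[K]_p) :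
  (forall i, f i x @[x --> F] --> M i) ->
  \prod_(i <- r | Q i) f i x @[x --> F] --> \prod_(i <- r | Q i) M i.
Proof.
move=> fM; elim: r => [|i r IH].
  by rewrite big_nil; under eq_cvg do rewrite big_nil; exact: cvg_cst.
rewrite big_cons; under eq_cvg do rewrite big_cons.
by case: (Q i) => //; exact: cvg_mulmx.
Qed.

End MatrixLimits.

(** * Pole placement *)

Section PolePlacement.
Context {K : fieldType} {n : nat}.
Implicit Types (A : 'M[K]_n) (b : 'cV[K]_n) (l : 'I_n -> K).

Definition krylov A b : 'M[K]_n := \matrix_(i < n, j < n) (A ^+ j *m b) i ord0.

(** The test [k.+1 == n] selects the last index and still makes sense for [n = 0]. *)
Definition control_row A b : 'rV[K]_n :=
  \row_(k < n) (k.+1 == n)%:R *m invmx (krylov A b).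

Definition placing_feedback A b l : 'rV[K]_n :=
  - (control_row A b *m \prod_(j < n) (A - (l j)%:M)).

Definition left_eigenmx A b l : 'M[K]_n :=
  \matrix_(i < n) (control_row A b *m \prod_(j < n | j != i) (A - (l j)%:M)).

Lemma col_krylov A b (j : 'I_n) : col j (krylov A b) = A ^+ j *m b.
Proof. by apply/colP => i; rewrite !mxE. Qed.

Lemma control_row_krylov A b (j : 'I_n) : krylov A b \in unitmx ->
  control_row A b *m (A ^+ j *m b) = (j.+1 == n)%:R%:M.
Proof.
move=> Ku; rewrite -col_krylov colE mulmxA mulmxKV ?unitmxE -?unitmxE // -colE.
by apply/matrixP => i k; rewrite !ord1 !mxE eqxx.
Qed.

End PolePlacement.

Section PolePlacementTheory.
Context {K : fieldType}.

(** With [w] the control row, [w A^j b] is 0 for [j < n'] and 1 for [j = n']; by linearity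
    [w p(A) b] reads off the coefficient of degree [n']. *)
Lemma control_row_horner (n' : nat) (A : 'M[K]_n'.+1) (b : 'cV[K]_n'.+1)
    (p : {poly K}) :
  krylov A b \in unitmx -> (size p <= n'.+1)%N ->
  control_row A b *m (horner_mx A p *m b) = (p`_n')%:M.
Proof.
move=> Ku sp; have -> : p = \sum_(j < n'.+1) p`_j *: 'X^j.
  by rewrite -poly_def; apply/polyP => i; rewrite coef_poly;
     case: ltnP => // ni; rewrite nth_default // (leq_trans sp).
rewrite raddf_sum mulmx_suml mulmx_sumr /=.
under eq_bigr => j _.
  rewrite linearZ /= rmorphXn /= horner_mx_X -scalemxAl -scalemxAr.
  rewrite control_row_krylov // eqSS scale_scalar_mx.
  over.
rewrite big_ord_recr /= eqxx mulr1 big1 ?add0r; last first.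
  by move=> i _; rewrite (ltn_eqF (ltn_ord i)) mulr0 raddf0.
congr (_%:M).
by rewrite -poly_def coef_poly ltnSn.
Qed.

(** Moves products of matrices into the commutative ring of polynomials, where factors can be
    reordered and degrees counted. *)
Lemma shift_prod_horner (n' : nat) (A : 'M[K]_n'.+1) (I : Type) (r : seq I)
    (Q : pred I) (l : I -> K) :
  \prod_(j <- r | Q j) (A - (l j)%:M) =
  horner_mx A (\prod_(j <- r | Q j) ('X - (l j)%:P)).
Proof.
rewrite rmorph_prod; apply: eq_bigr => j _.
by rewrite rmorphB /= horner_mx_X horner_mx_C.
Qed.

(** Row [i] is [w q(A)] with [q] monic of degree [n - 1], and [w q(A) b] is the leading coefficient
    of [q]. *)
Lemma left_eigenmx_b (n : nat) (A : 'M[K]_n) (b : 'cV[K]_n)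
    (l : 'I_n -> K) : krylov A b \in unitmx ->
  left_eigenmx A b l *m b = const_mx 1.
Proof.
case: n => [|n'] in A b l *; move=> Ku; first by apply/matrixP => -[].
apply/row_matrixP => i; rewrite row_mul rowK -mulmxA.
rewrite shift_prod_horner.
have mq : \prod_(j < n'.+1 | j != i) ('X - (l j)%:P) \is monic.
  by apply: monic_prod => j _; exact: monicXsubC.
have sz : size (\prod_(j < n'.+1 | j != i) ('X - (l j)%:P)) = n'.+1.
  rewrite size_prod; last by move=> j _; rewrite polyXsubC_eq0.
  under eq_bigr do rewrite size_XsubC.
  rewrite sum_nat_const cardC1 card_ord /=; lia.
rewrite control_row_horner ?sz //.
move/monicP: mq; rewrite lead_coefE sz /= => ->.
by apply/matrixP => j k; rewrite !ord1 !mxE eqxx.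
Qed.

(** Let [w_i] be row [i] of [left_eigenmx A b l] and [F] the feedback. Then [w_i b = 1] and
    [F = - w_i (A - l_i)], so [w_i (A + b F) = w_i A - w_i (A - l_i) = l_i w_i]. *)
Lemma left_eigenmx_feedback (n : nat) (A : 'M[K]_n) (b : 'cV[K]_n)
    (l : 'I_n -> K) : krylov A b \in unitmx ->
  left_eigenmx A b l *m (A + b *m placing_feedback A b l) =
  diag_mx (\row_i l i) *m left_eigenmx A b l.
Proof.
case: n => [|n'] in A b l *; move=> Ku; first by apply/matrixP => -[].
rewrite mulmxDr (mulmxA _ b) left_eigenmx_b //.
apply/row_matrixP => i; rewrite row_mul row_diag_mx -scalemxAl -rowE mxE linearD /=.
rewrite !row_mul !rowK.
have -> : row i (const_mx 1 : 'cV[K]_n'.+1) = 1%:M.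
  by apply/matrixP => j k; rewrite !ord1 !mxE eqxx.
rewrite mul1mx /placing_feedback.
have comm : \prod_(j < n'.+1) (A - (l j)%:M) =
            \prod_(j < n'.+1 | j != i) (A - (l j)%:M) *m (A - (l i)%:M).
  rewrite !shift_prod_horner (bigD1 i) //= mulrC rmorphM /=.
  by rewrite rmorphB /= horner_mx_X horner_mx_C.
rewrite comm mulmxBr mulmxBr mulmxA opprB addrC subrK.
by rewrite mul_mx_scalar -scalemxAr.
Qed.

Lemma left_eigenmx_exp (n : nat) (L M : 'M[K]_n) (l : 'I_n -> K) (k : nat) :
  L *m M = diag_mx (\row_i l i) *m L ->
  L *m M ^+ k = diag_mx (\row_i l i ^+ k) *m L.
Proof.
move=> LM; elim: k => [|k IH].
  rewrite expr0 mulmx1 (_ : \row_i _ = const_mx 1) ?diag_const_mx ?mul1mx //.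
  by apply/rowP => i; rewrite !mxE.
rewrite exprSr [_ * M]/(_ *m M) mulmxA IH -mulmxA LM mulmxA mulmx_diag.
by congr (diag_mx _ *m _); apply/rowP => i; rewrite !mxE exprSr.
Qed.

(** Multiplying by the Krylov matrix of the closed-loop pair gives the matrix of the powers [l_i^j],
    a transposed Vandermonde matrix with distinct nodes. A factor of an invertible square matrix is
    invertible. *)
Lemma left_eigenmx_unit (n : nat) (A : 'M[K]_n) (b : 'cV[K]_n)
    (l : 'I_n -> K) : krylov A b \in unitmx -> injective l ->
  left_eigenmx A b l \in unitmx.
Proof.
move=> Ku linj; set L := left_eigenmx A b l.
have LM := left_eigenmx_feedback l Ku; rewrite -/L in LM.
set M := A + _ in LM.
have LV : L *m krylov M b = (Vandermonde n (\row_i l i))^T.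
  apply/matrixP => i j; rewrite !mxE.
  transitivity ((L *m (M ^+ j *m b)) i ord0).
    by rewrite mxE; apply: eq_bigr => k _; rewrite !mxE.
  rewrite mulmxA (left_eigenmx_exp j LM) -mulmxA left_eigenmx_b //.
  by rewrite mul_diag_mx !mxE mulr1.
have : L *m krylov M b \in unitmx.
  rewrite LV unitmx_tr unitmxE det_Vandermonde unitfE.
  apply/prodf_neq0 => i _; apply/prodf_neq0 => j ij.
  by rewrite !mxE subr_eq0 (inj_eq linj) neq_ltn ij orbT.
by rewrite unitmx_mul => /andP[].
Qed.

End PolePlacementTheory.

(** * The Weierstrass approximation theorem *)

Section Weierstrass.
Context {R : realType}.

(* The Bernstein polynomial of degree n with weights f 0, ..., f n, written
   through the recursion of de Casteljau's algorithm. *)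
Fixpoint bernstein (n : nat) (f : nat -> R) : {poly R} :=
  if n is n'.+1 then
    'X * bernstein n' (fun k => f k.+1) + (1 - 'X) * bernstein n' f
  else (f 0%N)%:P.

(** For [r = 0] and [s = 1] this is the second moment about [c] of a binomial law: variance plus
    squared bias. Passing to the weights [f k.+1] replaces [c] by [c - 1], so [c] varies in the
    induction. *)
Lemma bernstein_square (n : nat) (r s c x : R) :
  (bernstein n (fun k => r + s * (k%:R - c) ^+ 2)).[x] =
  r + s * (n%:R * (x * (1 - x)) + (n%:R * x - c) ^+ 2).
Proof.
elim: n c => [|n IH] c /=; first by rewrite hornerC; ring.
have shift : (fun k => r + s * (k.+1%:R - c) ^+ 2) =
             (fun k => r + s * (k%:R - (c - 1)) ^+ 2).
  by apply/funext => k; rewrite -natr1; ring.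
rewrite shift (_ : horner _ _ =
  x * (bernstein n (fun k => r + s * (k%:R - (c - 1)) ^+ 2)).[x] +
  (1 - x) * (bernstein n (fun k => r + s * (k%:R - c) ^+ 2)).[x]).
  by rewrite !IH -natr1; ring.
by rewrite !hornerE.
Qed.

(** For [x] in the unit interval each step of the recursion is a convex combination, which preserves
    the bound. *)
Lemma bernstein_dist (n : nat) (f g : nat -> R) (c x : R) : 0 <= x <= 1 ->
  (forall k, (k <= n)%N -> `|f k - c| <= g k) ->
  `|(bernstein n f).[x] - c| <= (bernstein n g).[x].
Proof.
move=> /andP[x0 x1]; elim: n f g => [|n IH] f g fg /=.
  by rewrite !hornerC; exact: fg.
rewrite !hornerE.
have := IH (fun k => f k.+1) (fun k => g k.+1) (fun k kn => fg k.+1 kn).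
have := IH f g (fun k kn => fg k (leqW kn)).
move: (horner _ _) (horner _ _) (horner _ _) (horner _ _) => p q p' q'.
rewrite !ler_norml => /andP[h1 h2] /andP[h3 h4]; apply/andP; split; nra.
Qed.

(** Compactness in its near-covering form, with the increment [y - x] running through [nbhs 0]. Only
    [x] is confined to the segment. *)
Lemma unif_continuous_segment (f : R -> R) (a b e : R) :
  continuous f -> 0 < e ->
  exists2 d : R, 0 < d & forall x y : R,
    a <= x <= b -> `|y - x| < d -> `|f y - f x| < e.
Proof.
move=> fC e0.
have := @segment_compact R a b; rewrite compact_near_coveringP.
move=> /(_ R (nbhs (0 : R)) (fun d x => `|f (x + d) - f x| < e)).
have shift_near : forall x : R, `[a, b] x ->
    \forall x' \near x & d \near 0, `|f (x' + d) - f x'| < e.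
  move=> x _.
  have cvg_diff : f (z.1 + z.2) - f z.1 @[z --> (nbhs x, nbhs (0 : R))] -->
                  f (x + 0) - f x.
    apply: cvgB; last by apply: continuous_cvg; [exact: fC|exact: cvg_fst].
    apply: continuous_cvg; first exact: fC.
    by apply: cvgD; [exact: cvg_fst|exact: cvg_snd].
  rewrite addr0 subrr in cvg_diff.
  move/cvgr0Pnorm_lt: cvg_diff => /(_ _ e0); exact.
move=> /(_ _ shift_near) /nbhs_ballP[d /= d0 dP]; exists d => // x y xab yxd.
have := dP (y - x); rewrite /ball /= sub0r normrN => /(_ yxd x).
by rewrite /= in_itv /= xab (addrC x) subrK; apply.
Qed.

(** Bernstein's proof: [f (k/n)] differs from [f x] by at most [e/2 + s (k/n - x)^2], the first term
    serving [k/n] near [x] and the second the other [k]. The Bernstein average of this bound is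
    [e/2 + s x (1 - x) / n]. *)
Lemma weierstrass01 (f : R -> R) (e : R) : continuous f -> 0 < e ->
  exists p : {poly R}, forall x : R, 0 <= x <= 1 -> `|p.[x] - f x| <= e.
Proof.
move=> fC e0; have e20 : 0 < e / 2 by rewrite divr_gt0.
have [d d0 fd] := unif_continuous_segment 0 1 fC e20.
have [M M0 fM] : exists2 M : R, 0 <= M &
    forall x y : R, 0 <= x <= 1 -> 0 <= y <= 1 -> `|f y - f x| <= M.
  have fW (h : R -> R) : continuous h -> {within `[(0:R), 1], continuous h}.
    by move=> hC; apply: continuous_subspaceT.
  have nC : continuous (fun x => `|f x|).
    by move=> x; apply: cvg_norm; exact: fC.
  have [c _ cmax] := EVT_max ler01 (fW _ nC).
  exists (`|f c| + `|f c|) => [|x y x01 y01]; first by rewrite addr_ge0.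
  by rewrite (le_trans (ler_normB _ _)) // lerD // cmax // in_itv.
(* With this [s] the quadratic term is at least the oscillation bound [M] as soon as [k/n] is at
   distance [d] or more from [x]. *)
pose s := M / d ^+ 2; have s0 : 0 <= s by rewrite divr_ge0 // sqr_ge0.
have [n n0 sn] : exists2 n : nat, (0 < n)%N & s / n%:R <= e / 2.
  exists (Num.truncn (s / (e / 2))).+1 => //.
  rewrite ler_pdivrMr ?ltr0n // mulrC -ler_pdivrMr //.
  by apply: ltW; exact: truncnS_gt.
have nr0 : (0 : R) < n%:R by rewrite ltr0n.
exists (bernstein n (fun k => f (k%:R / n%:R))) => x x01.
(* The majorant is centred at [n x], so the squared bias vanishes and only the variance remains. *)
have := @bernstein_dist n (fun k => f (k%:R / n%:R))
  (fun k => e / 2 + s / n%:R ^+ 2 * (k%:R - n%:R * x) ^+ 2) (f x) x x01.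
rewrite bernstein_square subrr expr0n /= addr0 => dist.
apply: le_trans (dist _) _ => [k kn|]; last first.
  have -> : s / n%:R ^+ 2 * (n%:R * (x * (1 - x))) = s / n%:R * (x * (1 - x)).
    by field; rewrite gt_eqF.
  have : 0 <= s / n%:R by rewrite divr_ge0 // ltW.
  by move: (s / n%:R) sn x01 => t tn /andP[x0 x1]; nra.
have -> : s / n%:R ^+ 2 * (k%:R - n%:R * x) ^+ 2 = s * (k%:R / n%:R - x) ^+ 2.
  by field; rewrite gt_eqF.
have k01 : 0 <= (k%:R / n%:R : R) <= 1.
  by rewrite divr_ge0 ?ler0n //= ler_pdivrMr // mul1r ler_nat.
have [near_x|far_x] := ltP `|k%:R / n%:R - x| d.
  rewrite (le_trans (ltW (fd _ _ x01 near_x))) // lerDl.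
  by rewrite mulr_ge0 // sqr_ge0.
apply: le_trans (fM _ _ x01 k01) _.
have : M <= s * (k%:R / n%:R - x) ^+ 2.
  rewrite /s mulrAC ler_pdivlMr ?exprn_gt0 // ler_wpM2l //.
  by rewrite -[leRHS]real_normK ?num_real // lerXn2r ?nnegrE // ltW.
by lra.
Qed.

Lemma weierstrass (f : R -> R) (a b e : R) : a < b -> continuous f -> 0 < e ->
  exists p : {poly R}, forall x : R, a <= x <= b -> `|p.[x] - f x| <= e.
Proof.
move=> ab fC e0.
have gC : continuous (fun x => f (a + (b - a) * x)).
  have affC : continuous (fun x : R => a + (b - a) * x).
    by move=> x; apply: cvgD; [|apply: cvgM; [|exact: cvg_id]]; exact: cvg_cst.
  by move=> x; exact: (cvg_comp _ _ (affC x) (fC _)).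
have [p pP] := weierstrass01 gC e0.
have ba0 : b - a != 0 by rewrite subr_eq0 gt_eqF.
exists (p \Po ((b - a)^-1 *: ('X - a%:P))) => x /andP[ax xb].
rewrite horner_comp !hornerE.
have := pP ((b - a)^-1 * (x - a)); rewrite mulVKf // (addrC a) subrK; apply.
by rewrite mulrC divr_ge0 ?subr_ge0 ?(ltW ab) //= ler_pdivrMr ?subr_gt0 // mul1r
           lerD2r.
Qed.

End Weierstrass.

(** * The arc *)

Section ComplexTopology.
Context {R : realType}.

Lemma normc_realE (x : R) : `|x%:C| = `|x|%:C.
Proof. by rewrite normc_def /= expr0n addr0 sqrtr_sqr. Qed.

Lemma norm_Re_le (z : R[i]) (d : R) : `|z| <= d%:C -> `|complex.Re z| <= d.
Proof.
by move=> zd; rewrite -lecR -normc_realE; apply: le_trans zd;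
   rewrite normc_realE normc_ge_Re.
Qed.

Lemma norm_Im_le (z : R[i]) (d : R) : `|z| <= d%:C -> `|complex.Im z| <= d.
Proof.
(* Multiplication by ['i] preserves the modulus and turns the imaginary part into minus the real
   part. *)
move=> zd; have := @norm_Re_le (z * 'i) d.
rewrite ReiNIm normrN; apply.
by rewrite normrM [`|'i|]normc_def /= expr0n /= expr1n add0r sqrtr1 mulr1.
Qed.

Lemma continuous_Re : continuous (@complex.Re R).
Proof.
move=> z; apply/(@cvgrPdist_le R R^o R[i] (nbhs z) (nbhs_filter z)) => e e0.
apply/(@nbhs_ballP _ R[i]^o); exists e%:C => /=; first by rewrite ltcR.
move=> w; rewrite /ball /= => /ltW zw.
by rewrite -(raddfB (@complex.Re R)); exact: norm_Re_le.
Qed.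

Lemma continuous_Im : continuous (@complex.Im R).
Proof.
move=> z; apply/(@cvgrPdist_le R R^o R[i] (nbhs z) (nbhs_filter z)) => e e0.
apply/(@nbhs_ballP _ R[i]^o); exists e%:C => /=; first by rewrite ltcR.
move=> w; rewrite /ball /= => /ltW zw.
by rewrite -(raddfB (@complex.Im R)); exact: norm_Im_le.
Qed.

Lemma continuous_real_complex : continuous (real_complex R : R -> R[i]).
Proof.
move=> x; apply/(@cvgrPdist_le R[i] R[i]^o R (nbhs x) (nbhs_filter x)) => e e0.
have e_real : e = (complex.Re e)%:C.
  by rewrite RRe_real // realE ltW.
have Re0 : 0 < complex.Re e by move: e0; rewrite e_real ltcR.
apply/nbhs_ballP; exists (complex.Re e) => //= y; rewrite /ball /= => /ltW xy.
by rewrite -rmorphB /= normc_realE e_real lecR.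
Qed.

Lemma complex_hausdorff : hausdorff_space R[i].
Proof. exact: (@norm_hausdorff _ R[i]^o). Qed.

End ComplexTopology.

Section JordanArc.
Context {R : realType}.

(** For [a <= b], the retraction of the line onto the segment. Composing with it extends a
    continuous map on the segment to the whole line. *)
Definition clamp (a b t : R) : R := Num.max a (Num.min b t).

Lemma clamp_itv (a b t : R) : a <= b -> a <= clamp a b t <= b.
Proof.
by move=> ab; rewrite /clamp le_max lexx ge_max ab ge_min lexx.
Qed.

Lemma clamp_id (a b t : R) : a <= t <= b -> clamp a b t = t.
Proof. by move=> /andP[at_ tb]; rewrite /clamp min_r // max_r. Qed.

Lemma continuous_clamp (a b : R) : continuous (clamp a b).
Proof.
move=> t; apply: (@continuous_max _ _ (cst a)); first exact: cvg_cst.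
by apply: (@continuous_min _ _ (cst b)); [exact: cvg_cst|exact: cvg_id].
Qed.

(** A continuous injection of a compact space into a Hausdorff space has a continuous inverse on its
    image. The parametrization is extended to the line by [clamp], so its continuity no longer
    refers to a subspace. *)
Lemma jordan_arc_param (P : set R[i]) : jordan_arc P ->
  exists (a b : R) (g : R -> R[i]) (tau : R[i] -> R),
    [/\ a < b, continuous g, {within P, continuous tau},
        forall t, P (g t) &
        forall z, P z -> a <= tau z <= b /\ g (tau z) = z].
Proof.
move=> [a [b [g [ab [gC [ginj PE]]]]]].
pose h t := g (clamp a b t).
have ab' := ltW ab.
have hg t : a <= t <= b -> h t = g t by move=> ht; rewrite /h clamp_id.
have hC : continuous h.
  move=> t.
  have := gC; rewrite subspace_continuousP => /(_ (clamp a b t)).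
  rewrite /= in_itv /= clamp_itv // => /(_ isT) gt.
  move=> A nA; have := continuous_clamp (gt A nA).
  by apply: (@filterS _ _ (nbhs_filter t)) => x /=; apply; rewrite /= in_itv /= clamp_itv.
have Ph t : P (h t).
  by rewrite PE; exists (clamp a b t) => //; rewrite /= in_itv /= clamp_itv.
(* The inverse parametrization; off [P] it takes the default value [a]. *)
pose tau z := xget a [set t | a <= t <= b /\ h t = z].
have tauP z : P z -> a <= tau z <= b /\ h (tau z) = z.
  rewrite PE => -[t]; rewrite /= in_itv /= => tab gtz.
  by apply: (@xgetPex _ a [set t | a <= t <= b /\ h t = z]); exists t;
     rewrite /= hg.
exists a, b, h, tau; split=> //.
apply/continuous_closedP => C closedC.
(* The preimage of [C] under [tau] is the image under [h] of a compact set, hence closed. *)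
apply/closed_subspaceP; exists (h @` (`[a, b] `&` C)).
  apply: compact_closed; first exact: complex_hausdorff.
  apply: continuous_compact; first exact: continuous_subspaceT.
  by apply: compact_closedI => //; exact: segment_compact.
have hinj s t : a <= s <= b -> a <= t <= b -> h s = h t -> s = t.
  by move=> sab tab; rewrite !hg //; apply: ginj; rewrite inE /= in_itv.
apply/seteqP; split=> z /=.
  move=> [[t [tab Ct] <-] _]; split => //.
  rewrite /= in_itv /= in tab.
  have [tau_ab htau] := tauP _ (Ph t).
  by move: Ct; rewrite -{1}(hinj _ _ tau_ab tab htau).
move=> [Ctau Pz]; split=> //; have [tau_ab htau] := tauP _ Pz.
by exists (tau z) => //; split => //; rewrite in_itv.
Qed.

End JordanArc.

(** * Uniform approximation on the arc *)

Section UniformApproximation.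
Context {R : realType}.

(* The images of [a, b] under [node a b i], i < n, are pairwise disjoint
   intervals contained in [2, +oo[. *)
Definition node (a b : R) (i : nat) (t : R) : R :=
  t - a + 2 + 2 * i%:R * (b - a).

Lemma continuous_node (a b : R) (i : nat) : continuous (node a b i).
Proof.
move=> t; apply: cvgD; last exact: cvg_cst.
by apply: cvgD; [apply: cvgB; [exact: cvg_id|exact: cvg_cst]|exact: cvg_cst].
Qed.

Lemma node_ge2 (a b : R) (i : nat) (t : R) : a < b -> a <= t -> 2 <= node a b i t.
Proof.
move=> ab at_; have : 0 <= 2 * i%:R * (b - a).
  by rewrite !mulr_ge0 ?ler0n // subr_ge0 ltW.
by rewrite /node; lra.
Qed.

Lemma node_inj (a b t : R) (i j : nat) :
  a < b -> node a b i t = node a b j t -> i = j.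
Proof.
move=> ab /addrI /mulIf; rewrite subr_eq0 gt_eqF // => /(_ isT) /mulfI.
by rewrite pnatr_eq0 => /(_ isT) /eqP; rewrite eqr_nat => /eqP.
Qed.

(** A trapezoidal cut-off: [clamp a b x] is the point of the segment closest to [x], so for [a < b]
    the value falls linearly from 1 on the segment to 0 at distance [b - a]. *)
Definition tent (a b x : R) : R := Num.max 0 (1 - `|x - clamp a b x| / (b - a)).

Lemma continuous_tent (a b : R) : continuous (tent a b).
Proof.
move=> x; apply: (@continuous_max _ _ (cst 0)
  (fun x => 1 - `|x - clamp a b x| / (b - a))); first exact: cvg_cst.
apply: cvgB; first exact: cvg_cst.
apply: cvgM; last exact: cvg_cst.
by apply: cvg_norm; apply: cvgB; [exact: cvg_id|exact: continuous_clamp].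
Qed.

Lemma tent1 (a b x : R) : a <= x <= b -> tent a b x = 1.
Proof.
by move=> ab; rewrite /tent clamp_id // subrr normr0 mul0r subr0 max_r // ler01.
Qed.

Lemma tent0 (a b x : R) : a < b -> x <= a - (b - a) \/ b + (b - a) <= x ->
  tent a b x = 0.
Proof.
move=> ab far; rewrite /tent max_l // subr_le0 ler_pdivlMr ?subr_gt0 // mul1r.
rewrite /clamp; case: far => far.
  rewrite min_r ?max_l; [|lra|lra].
  by rewrite ler_normr; apply/orP; right; lra.
rewrite min_l ?max_r; [|lra|lra].
by rewrite ler_normr; apply/orP; left; lra.
Qed.

(** Each [phi i] is transported to the [i]-th node interval and cut off by a tent; their sum [h] is
    one continuous function on the line, to which Weierstrass applies once. *)
Lemma weierstrass_nodes (n : nat) (phi : 'I_n -> R -> R) (a b e : R) :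
  a < b -> (forall i, continuous (phi i)) -> 0 < e ->
  exists p : {poly R}, forall (i : 'I_n) (t : R), a <= t <= b ->
    `|p.[node a b i t] - phi i t| <= e.
Proof.
move=> ab phiC e0; have ba0 : 0 < b - a by rewrite subr_gt0.
pose back i x : R := x + a - 2 - 2 * i%:R * (b - a).
have backK i : cancel (node a b i) (back i) by move=> t; rewrite /back /node; ring.
pose h x := \sum_(i < n) tent (node a b i a) (node a b i b) x * phi i (back i x).
have hC : continuous h.
  move=> x; apply: cvg_bigsum => i; apply: cvgM; first exact: continuous_tent.
  have backC : back i y @[y --> x] --> back i x.
    apply: cvgB; last exact: cvg_cst.
    apply: cvgB; last exact: cvg_cst.
    by apply: cvgD; [exact: cvg_id|exact: cvg_cst].
  exact: (cvg_comp _ _ backC (phiC i _)).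
(* The interval from 2 to this bound contains all node intervals and is nondegenerate even for
   [n = 0]. *)
have lt2n : 2 < 3 + 2 * n%:R * (b - a).
  have : 0 <= 2 * n%:R * (b - a) by rewrite !mulr_ge0 ?ler0n // ltW.
  by lra.
have hnode (i : 'I_n) t : a <= t <= b -> h (node a b i t) = phi i t.
  move=> /andP[at_ tb]; rewrite /h (bigD1 i) //= backK tent1; last first.
    by rewrite /node; apply/andP; split; lra.
  rewrite mul1r big1 ?addr0 // => j ji; rewrite tent0 ?mul0r //.
    by rewrite /node; lra.
  (* Distinct node intervals are at least [b - a] apart, where the tent of the other one already
     vanishes. *)
  have [ltji|ltij] : (j.+1 <= i)%N \/ (i.+1 <= j)%N by move: ji; rewrite -val_eqE /=; lia.
  - right; have : (j%:R + 1 <= i%:R :> R) by rewrite natr1 ler_nat.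
    by rewrite /node; move: (j%:R : R) (i%:R : R) => u v; nra.
  - left; have : (i%:R + 1 <= j%:R :> R) by rewrite natr1 ler_nat.
    by rewrite /node; move: (j%:R : R) (i%:R : R) => u v; nra.
have [p pP] := weierstrass lt2n hC e0.
exists p => i t tab; rewrite -(hnode i t tab); apply: pP.
rewrite node_ge2 //=; last by case/andP: tab.
have : (i%:R + 1 <= n%:R :> R) by rewrite natr1 ler_nat.
by rewrite /node; case/andP: tab => _; move: (i%:R : R) (n%:R : R) => u v; nra.
Qed.

(** The nodes are real, so real polynomials [p] and [q] for the real and imaginary parts combine
    into [p + 'i q]. *)
Lemma complex_weierstrass_nodes (n : nat) (phi : 'I_n -> R -> R[i]) (a b e : R) :
  a < b -> (forall i, continuous (phi i)) -> 0 < e ->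
  exists p : {poly R[i]}, forall (i : 'I_n) (t : R), a <= t <= b ->
    `|p.[(node a b i t)%:C] - phi i t| <= e%:C.
Proof.
move=> ab phiC e0; have e20 : 0 < e / 2 by rewrite divr_gt0.
have reC i : continuous (fun t => complex.Re (phi i t)).
  by move=> t; exact: (continuous_comp (phiC i t) (@continuous_Re R _)).
have imC i : continuous (fun t => complex.Im (phi i t)).
  by move=> t; exact: (continuous_comp (phiC i t) (@continuous_Im R _)).
have [p pP] := weierstrass_nodes ab reC e20.
have [q qP] := weierstrass_nodes ab imC e20.
exists (map_poly (real_complex R) p + 'i *: map_poly (real_complex R) q) => i t tab.
rewrite hornerD hornerZ !horner_map /= [phi i t]complexE.
rewrite opprD addrACA -mulrBr -!rmorphB /=.
apply: le_trans (ler_normD _ _) _.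
have norm_i : `|'i : R[i]| = 1.
  by rewrite normc_def /= expr0n /= expr1n add0r sqrtr1.
rewrite normrM norm_i mul1r !normc_realE -rmorphD lecR /=.
by rewrite [leRHS](splitr e) lerD // ?pP ?qP.
Qed.

Lemma continuous_comp_within {U : topologicalType} (P : set R[i])
    (f : R[i] -> U) (g : R -> R[i]) :
  {within P, continuous f} -> continuous g -> (forall t, P (g t)) ->
  continuous (fun t => f (g t)).
Proof.
move=> fC gC Pg t A nA.
move: fC; rewrite subspace_continuousP => /(_ (g t) (Pg t) A nA) nfA.
by apply: (@filterS _ _ (nbhs_filter t) _ _ _ (gC t _ nfA)) => s /=; apply.
Qed.

(** The coordinates [V^-1 f], pulled back to the parameter line by [g], are continuous and can be
    approximated at the nodes. Multiplying back by [V] enlarges the error at most by its largest row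
    sum, bounded by compactness. *)
Lemma ensemble_approx (n : nat) (P : set R[i]) (a b : R) (g : R -> R[i])
    (tau : R[i] -> R) (V : R[i] -> 'M[R[i]]_n) (f : R[i] -> 'cV[R[i]]_n) (e : R) :
  a < b -> continuous g -> (forall t, P (g t)) ->
  (forall z, P z -> a <= tau z <= b /\ g (tau z) = z) ->
  {within P, continuous V} -> {within P, continuous f} ->
  (forall z, P z -> V z \in unitmx) -> 0 < e ->
  exists p : {poly R[i]}, exists2 d : R, d < e &
    forall z, P z ->
    `|V z *m (\col_i p.[(node a b i (tau z))%:C]) - f z| <= d%:C.
Proof.
move=> ab gC Pg tauP VC fC Vu e0.
have VgC := continuous_comp_within VC gC Pg.
have fgC := continuous_comp_within fC gC Pg.
pose c t := invmx (V (g t)) *m f (g t).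
have cC i : continuous (fun t => c t i ord0).
  move=> t.
  have : c s @[s --> t] --> c t.
    apply: (cvg_mulmx (F := nbhs t) (f := fun s => invmx (V (g s)))
      (g := fun s => f (g s))).
      by apply: (cvg_invmx (F := nbhs t) (f := fun s => V (g s)));
         [exact: Vu|by apply: nearW => s; exact: Vu|exact: VgC].
    exact: (fgC t).
  by move=> ct; exact: ((cvg_mxP (F := nbhs t) c (c t)).1 ct i ord0).
have [M M0 VM] : exists2 M : R, 0 <= M & forall t, a <= t <= b ->
    forall i, \sum_j `|V (g t) i j| <= M%:C.
  pose N t := \sum_i \sum_j complex.Re `|V (g t) i j|.
  have NC : continuous N.
    move=> t; apply: cvg_bigsum => i; apply: cvg_bigsum => j.
    have Vij : V (g s) i j @[s --> t] --> V (g t) i j.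
      exact: ((cvg_mxP (F := nbhs t) (fun s => V (g s)) (V (g t))).1 (VgC t) i j).
    have nVij : (`|V (g s) i j| : R[i]) @[s --> t] --> (`|V (g t) i j| : R[i]).
      exact: (@cvg_norm _ R[i]^o).
    exact: (continuous_comp (f := fun s => `|V (g s) i j| : R[i])
      nVij (@continuous_Re R _)).
  have [t0 _ maxN] := EVT_max (ltW ab) (continuous_subspaceT NC).
  have ReV t i j : 0 <= complex.Re `|V (g t) i j|.
    by rewrite normc_def /= sqrtr_ge0.
  exists (N t0) => [|t tab i]; first by apply: sumr_ge0 => k _; apply: sumr_ge0 => j _.
  have -> : \sum_j `|V (g t) i j| = (\sum_j complex.Re `|V (g t) i j|)%:C.
    rewrite rmorph_sum; apply: eq_bigr => j _.
    by apply/esym/RRe_real; exact: normr_real.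
  rewrite lecR; apply: le_trans (maxN t _); last by rewrite in_itv.
  rewrite /N [leRHS](bigD1 i) //= lerDl.
  apply: sumr_ge0 => k _; apply: sumr_ge0 => j _. exact: ReV.
(* Adding 1 to [M] keeps the divisor positive; halving [e] gives the strict inequality required of
   the bound. *)
pose d := e / 2 / (M + 1).
have M10 : 0 < M + 1 by rewrite ltr_wpDl.
have d0 : 0 < d by rewrite !divr_gt0.
have [p pP] := complex_weierstrass_nodes ab cC d0.
exists p; exists (e / 2) => [|z Pz]; first by lra.
have [tab gz] := tauP _ Pz.
have -> : f z = V z *m c (tau z).
  by rewrite /c gz mulKVmx // Vu.
rewrite -mulmxBr; apply: mx_norm_le => [|i j]; first by rewrite ler0c; lra.
rewrite mxE; apply: le_trans (ler_norm_sum _ _ _) _.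
apply: (@le_trans _ _ (\sum_k `|V z i k| * d%:C)).
  apply: ler_sum => k _; rewrite normrM ler_wpM2l //.
  have -> : ((\col_i p.[(node a b i (tau z))%:C]) - c (tau z)) k j =
            p.[(node a b k (tau z))%:C] - c (tau z) k ord0.
    by rewrite ord1 !mxE.
  exact: pP.
rewrite -mulr_suml.
apply: (@le_trans _ _ (M%:C * d%:C)).
  by rewrite ler_wpM2r ?ler0c ?(ltW d0) // -[in V z]gz VM.
rewrite -rmorphM lecR /= /d mulrCA ger_pMr ?divr_gt0 //.
by rewrite ler_pdivrMr // mul1r lerDl.
Qed.

End UniformApproximation.

(** * Continuity of the feedback *)

Section FeedbackContinuity.
Context {R : realType}.

Lemma kalman_krylov (n : nat) (A : 'M[R[i]]_n) (b : 'cV[R[i]]_n) :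
  kalman_reachable A b -> krylov A b \in unitmx.
Proof. by move=> rk; rewrite -row_free_unit /row_free /krylov rk. Qed.

Section Limits.
Context {K : numFieldType} {T : Type} (F : set_system T) {FF : Filter F}.
Context {n : nat} (A : T -> 'M[K]_n) (b : T -> 'cV[K]_n) (l : 'I_n -> T -> K).
Variables (A0 : 'M[K]_n) (b0 : 'cV[K]_n) (l0 : 'I_n -> K).
Hypothesis cvgA : A x @[x --> F] --> A0.
Hypothesis cvgb : b x @[x --> F] --> b0.
Hypothesis cvgl : forall i, l i x @[x --> F] --> l0 i.
Hypothesis unit0 : krylov A0 b0 \in unitmx.
Hypothesis unitF : \forall x \near F, krylov (A x) (b x) \in unitmx.

Lemma cvg_krylov : krylov (A x) (b x) @[x --> F] --> krylov A0 b0.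
Proof.
apply/cvg_mxP => i j; rewrite mxE; under eq_cvg do rewrite mxE.
exact: ((cvg_mxP _ _).1 (cvg_mulmx (cvg_mx_exp (k := j) cvgA) cvgb)).
Qed.

Lemma cvg_control_row : control_row (A x) (b x) @[x --> F] --> control_row A0 b0.
Proof.
apply: cvg_mulmx; first exact: cvg_cst.
exact: cvg_invmx cvg_krylov.
Qed.

Lemma cvg_shift_prod (Q : pred 'I_n) :
  \prod_(j < n | Q j) (A x - (l j x)%:M) @[x --> F] -->
  \prod_(j < n | Q j) (A0 - (l0 j)%:M).
Proof.
apply: (cvg_mx_prod (f := fun j x => A x - (l j x)%:M)) => j.
apply: cvgB => //; apply/cvg_mxP => i k; rewrite mxE.
under eq_cvg do rewrite mxE.
by case: (i == k); [exact: cvgl|exact: cvg_cst].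
Qed.

Lemma cvg_placing_feedback :
  placing_feedback (A x) (b x) (l^~ x) @[x --> F] --> placing_feedback A0 b0 l0.
Proof.
apply: cvgN.
exact (cvg_mulmx cvg_control_row (cvg_shift_prod (Q := xpredT))).
Qed.

Lemma cvg_left_eigenmx :
  left_eigenmx (A x) (b x) (l^~ x) @[x --> F] --> left_eigenmx A0 b0 l0.
Proof.
apply/cvg_mxP => i j; rewrite mxE; under eq_cvg do rewrite mxE.
exact: ((cvg_mxP _ _).1 (cvg_mulmx cvg_control_row (cvg_shift_prod (Q := predC1 i)))).
Qed.

End Limits.

Context {n : nat} (P : set R[i]) (A : R[i] -> 'M[R[i]]_n) (b : R[i] -> 'cV[R[i]]_n).
Variable l : 'I_n -> R[i] -> R[i].
Hypothesis AC : {within P, continuous A}.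
Hypothesis bC : {within P, continuous b}.
Hypothesis lC : forall i, {within P, continuous (l i)}.
Hypothesis reach : forall z, P z -> kalman_reachable (A z) (b z).

Lemma within_krylov_unit (z : R[i]) : P z ->
  \forall x \near within P (nbhs z), krylov (A x) (b x) \in unitmx.
Proof.
by move=> Pz; apply: (@filterS _ _ (nbhs_filter z) setT); [move=> x _ Px;
  exact: kalman_krylov (reach Px)|exact: filterT].
Qed.

Lemma within_continuous_placing_feedback :
  {within P, continuous (fun z => placing_feedback (A z) (b z) (l^~ z))}.
Proof.
apply/subspace_continuousP => z Pz.
apply: (cvg_placing_feedback (F := within P (nbhs z)) (l := l) (l0 := l^~ z)).
- exact: ((subspace_continuousP P A).1 AC z Pz).
- exact: ((subspace_continuousP P b).1 bC z Pz).
- by move=> i; exact: ((subspace_continuousP P (l i)).1 (@lC i) z Pz).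
- exact: kalman_krylov (reach Pz).
- exact: within_krylov_unit.
Qed.

Lemma within_continuous_left_eigenmx :
  {within P, continuous (fun z => left_eigenmx (A z) (b z) (l^~ z))}.
Proof.
apply/subspace_continuousP => z Pz.
apply: (cvg_left_eigenmx (F := within P (nbhs z)) (l := l) (l0 := l^~ z)).
- exact: ((subspace_continuousP P A).1 AC z Pz).
- exact: ((subspace_continuousP P b).1 bC z Pz).
- by move=> i; exact: ((subspace_continuousP P (l i)).1 (@lC i) z Pz).
- exact: kalman_krylov (reach Pz).
- exact: within_krylov_unit.
Qed.

Hypothesis linj : forall z, P z -> injective (l^~ z).

Lemma within_continuous_inv_left_eigenmx :
  {within P, continuous (fun z => invmx (left_eigenmx (A z) (b z) (l^~ z)))}.
Proof.
have unitL z : P z -> left_eigenmx (A z) (b z) (l^~ z) \in unitmx.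
  by move=> Pz; apply: left_eigenmx_unit (linj Pz); exact: kalman_krylov (reach Pz).
apply/subspace_continuousP => z Pz.
apply: (cvg_invmx (F := within P (nbhs z))
  (f := fun z => left_eigenmx (A z) (b z) (l^~ z))).
- exact: unitL.
- by apply: (@filterS _ _ (nbhs_filter z) setT); [move=> x _; exact: unitL
    |exact: filterT].
- exact: ((subspace_continuousP P _).1 within_continuous_left_eigenmx z Pz).
Qed.

End FeedbackContinuity.

(** * The discrete-time system *)

Section DiscreteTime.
Context {R : realType}.

(** In the coordinates given by [L], the vector [M ^+ k *m b] has entries [l i ^+ k]. The input
    lists the coefficients of [p] in reverse order, so that [M ^+ k *m b] is weighted by the
    coefficient of degree [k]. *)
Lemma dt_endpoint_eigen (n : nat) (L M : 'M[R[i]]_n) (b : 'cV[R[i]]_n)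
    (l : 'I_n -> R[i]) (p : {poly R[i]}) :
  L \in unitmx -> L *m M = diag_mx (\row_i l i) *m L -> L *m b = const_mx 1 ->
  dt_endpoint M b (size p) (fun k => (p`_((size p).-1 - k))%:M) =
  invmx L *m \col_i p.[l i].
Proof.
move=> Lu LM Lb; apply: (canRL (mulKmx Lu)); rewrite /dt_endpoint mulmx_sumr.
apply/colP => i; rewrite summxE mxE horner_coef; apply: eq_bigr => k _.
rewrite !mulmxA (left_eigenmx_exp k LM) -[_ *m L *m b]mulmxA Lb.
rewrite mul_mx_scalar mxE mul_diag_mx !mxE mulr1; congr (p`_ _ * _).
(* For [size p = 0] there is no index; otherwise reversing twice restores [k]. *)
by case: (size p) k => [[]|s] //= k; rewrite subKn // -ltnS.
Qed.

End DiscreteTime.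

(** * The continuous-time system *)

Section ContinuousTime.
Context {R : realType}.
Local Notation mu := (@lebesgue_measure R).

(** Conjugation by [L] turns the partial sums into diagonal matrices of scalar exponential partial
    sums. Since [expmx] is a [limn], convergence to a point of a Hausdorff space determines it. *)
Lemma expmx_eigen (n : nat) (L M : 'M[R[i]]_n) (l : 'I_n -> R) :
  L \in unitmx -> L *m M = diag_mx (\row_i (l i)%:C) *m L ->
  expmx M = invmx L *m diag_mx (\row_i (expR (l i))%:C) *m L.
Proof.
move=> Lu LM; apply: cvg_lim; first exact: (@norm_hausdorff _ 'M[R[i]^o]_n).
pose S (N : nat) : 'rV[R[i]]_n := \row_i (series (exp_coeff (l i)) N)%:C.
have -> : series (fun k : nat => (k`!%:R)^-1 *: M ^+ k) =
          fun N => invmx L *m diag_mx (S N) *m L.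
  apply/funext => N; rewrite -mulmxA; apply: (canRL (mulKmx Lu)).
  rewrite seriesEnat /= mulmx_sumr.
  have -> : diag_mx (S N) =
            \sum_(0 <= k < N) (k`!%:R)^-1 *: diag_mx (\row_i (l i)%:C ^+ k).
    apply/matrixP => i j; rewrite summxE !mxE /series /= rmorph_sum.
    rewrite -sumrMnl; apply: eq_bigr => k _.
    by rewrite !mxE /exp_coeff /= mulrnAr rmorphM rmorphXn fmorphV rmorph_nat mulrC.
  rewrite mulmx_suml; apply: eq_bigr => k _.
  by rewrite -scalemxAr (left_eigenmx_exp k LM) scalemxAl.
apply: (cvg_mulmx (F := \oo) (g := fun=> L)); last exact: cvg_cst.
apply: (cvg_mulmx (F := \oo) (f := fun=> invmx L)); first exact: cvg_cst.
apply/(cvg_mxP (F := \oo)) => i j; rewrite !mxE.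
under eq_cvg do rewrite !mxE.
case: (i == j); last exact: cvg_cst.
rewrite !mulr1n.
have := @is_cvg_series_exp_coeff R (l i).
move=> /(cvg_comp _ _) /(_ (@continuous_real_complex R _)); exact.
Qed.

(** Integrability and value go through one induction, because additivity at each step uses
    integrability of the remaining sum. *)
Lemma Rintegral_lincomb (d : measure_display) (T : measurableType d)
    (m : {measure set T -> \bar R}) (D : set T) (I : Type) (r : seq I)
    (c : I -> R) (h : I -> T -> R) :
  measurable D -> (forall i, m.-integrable D (EFin \o h i)) ->
  m.-integrable D (EFin \o (fun s => \sum_(i <- r) c i * h i s)) /\
  Rintegral m D (fun s => \sum_(i <- r) c i * h i s) =
  \sum_(i <- r) c i * Rintegral m D (h i).
Proof.
move=> mD hint; elim: r => [|i r [IHi IHe]].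
  rewrite big_nil; under [X in EFin \o X]eq_fun do rewrite big_nil.
  under eq_Rintegral do rewrite big_nil.
  split; last by rewrite Rintegral_cst // mul0r.
  exact: integrable0.
rewrite big_cons; under [X in EFin \o X]eq_fun do rewrite big_cons.
under eq_Rintegral do rewrite big_cons.
have ci : m.-integrable D (EFin \o (fun s => c i * h i s)).
  have -> : EFin \o (fun s => c i * h i s) =
            (fun s => (c i)%:E * (EFin \o h i) s)%E by apply/funext.
  exact: integrableZl.
split; last by rewrite RintegralD // RintegralZl // IHe.
exact: (integrableD mD ci IHi).
Qed.

Lemma Re_sum_real (I : Type) (r : seq I) (c : I -> R[i]) (x : I -> R) :
  complex.Re (\sum_(i <- r) c i * (x i)%:C) = \sum_(i <- r) complex.Re (c i) * x i.
Proof.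
elim: r => [|i r IH]; first by rewrite !big_nil.
rewrite !big_cons -IH; case: (c i) => u v; case: (\sum_(_ <- _) _) => w z /=.
by rewrite mulr0 subr0.
Qed.

Lemma Im_sum_real (I : Type) (r : seq I) (c : I -> R[i]) (x : I -> R) :
  complex.Im (\sum_(i <- r) c i * (x i)%:C) = \sum_(i <- r) complex.Im (c i) * x i.
Proof.
elim: r => [|i r IH]; first by rewrite !big_nil.
rewrite !big_cons -IH; case: (c i) => u v; case: (\sum_(_ <- _) _) => w z /=.
by rewrite mulr0 add0r.
Qed.

Lemma cintegral_lincomb (a b : R) (I : Type) (r : seq I) (c : I -> R[i])
    (h : I -> R -> R) :
  (forall i, mu.-integrable `[a, b] (EFin \o h i)) ->
  cintegral a b (fun s => \sum_(i <- r) c i * (h i s)%:C) =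
  \sum_(i <- r) c i * (Rintegral mu `[a, b] (h i))%:C.
Proof.
move=> hint.
have lin (c' : I -> R) : Rintegral mu `[a, b] (fun s => \sum_(i <- r) c' i * h i s) =
    \sum_(i <- r) c' i * Rintegral mu `[a, b] (h i).
  by apply: (Rintegral_lincomb r c' _ hint).2; exact: measurable_itv.
apply/eqP; rewrite eq_complex Re_sum_real Im_sum_real /=.
under eq_Rintegral do rewrite Re_sum_real.
rewrite lin eqxx /=.
under eq_Rintegral do rewrite Im_sum_real.
by rewrite lin.
Qed.

(* Consecutive pulses overlap, but only in a null set. *)
Definition pulse (k : nat) : R -> R := \1_`[k%:R, k.+1%:R].

Lemma integrable_pulse (T : R) (k : nat) (h : R -> R) : continuous h ->
  mu.-integrable `[0, T] (EFin \o (fun s => h s * pulse k s)).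
Proof.
move=> hC.
have hi : mu.-integrable `[0, T] (EFin \o h).
  apply: continuous_compact_integrable; first exact: segment_compact.
  exact: continuous_subspaceT.
have -> : EFin \o (fun s => h s * pulse k s) = (EFin \o h) \_ `[k%:R, k.+1%:R].
  by rewrite restrict_EFin patch_indic; apply/funext.
apply/integrable_restrict; try exact: measurable_itv.
by apply: integrableS hi; [exact: measurable_itv|
  apply: measurableI; exact: measurable_itv|exact: subIsetl].
Qed.

(** As [k < N], the pulse lies inside the domain, and the fundamental theorem of calculus applies
    with the antiderivative [- expR ((N - s) l) / l]. *)
Lemma Rintegral_exp_pulse (N k : nat) (l : R) : l != 0 -> (k < N)%N ->
  Rintegral mu `[0, N%:R] (fun s => expR ((N%:R - s) * l) * pulse k s) =
  (expR l - 1) / l * expR l ^+ (N - k.+1).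
Proof.
move=> l0 kN; pose E s := expR ((N%:R - s) * l); pose F s := - l^-1 * E s.
have dE (s : R) : is_derive s (1 : R) E (- l * E s).
  rewrite /E.
  apply: is_derive_eq.
  by rewrite scaler0 !add0r /GRing.scale /= /E; ring.
have dF (s : R) : is_derive s (1 : R) F (E s).
  rewrite /F; apply: is_derive_eq.
  by rewrite /GRing.scale /= mulrA mulrNN mulVf // mul1r.
have EC : continuous E.
  by move=> s; apply/differentiable_continuous/derivable1_diffP; case: (dE s).
have FC : continuous F.
  by move=> s; apply/differentiable_continuous/derivable1_diffP; case: (dF s).
have -> : (fun s => E s * pulse k s) = E \_ `[k%:R, k.+1%:R].
  by rewrite patch_indic; apply/funext.
rewrite -Rintegral_mkcondr setIidr; last first.
  move=> s /=; rewrite !in_itv /= => /andP[ks sk]; apply/andP; split.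
    by apply: le_trans ks.
  by apply: le_trans sk _; rewrite ler_nat.
rewrite /Rintegral (@continuous_FTC2 _ E F); first last.
- by move=> s _; rewrite derive1E; case: (dF s).
- split; first by move=> s _; case: (dF s).
  + exact: (@cvg_at_right_filter _ _ F _ _ (FC _)).
  + exact: (@cvg_at_left_filter _ _ F _ _ (FC _)).
- exact: continuous_subspaceT.
- by rewrite ltr_nat.
rewrite /= /F /E -expRM_natl natrB // -natr1.
have -> : (N%:R - k%:R) * l = (N%:R - (k%:R + 1)) * l + l by ring.
by rewrite expRD; field.
Qed.

(** The coefficients appear in reverse: after the pulse on [[k, k+1]] there remain [N - k - 1] units
    of time, which contribute that power of [expR l]. *)
Definition step_input (p : {poly R[i]}) (N : nat) (s : R) : 'cV[R[i]]_1 :=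
  (\sum_(k < N) p`_(N - k.+1) * (pulse k s)%:C)%:M.

Lemma step_input_L1 (p : {poly R[i]}) (N : nat) (T : R) :
  L1_input T (step_input p N).
Proof.
have pulse_int (k : nat) : mu.-integrable `[0, T] (EFin \o pulse k).
  have -> : pulse k = (fun s => cst 1 s * pulse k s).
    by apply/funext => s; rewrite mul1r.
  by apply: integrable_pulse => s; exact: cvg_cst.
have lin (c : 'I_N -> R) :
    mu.-integrable `[0, T] (EFin \o (fun s => \sum_(k < N) c k * pulse k s)).
  apply: (Rintegral_lincomb _ c _ (fun k : 'I_N => pulse_int k)).1.
  exact: measurable_itv.
move=> i; rewrite ord1; split.
- have -> : (fun s => (complex.Re (step_input p N s ord0 ord0))%:E) =
      EFin \o (fun s => \sum_(k < N) complex.Re p`_(N - k.+1) * pulse k s).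
    by apply/funext => s; rewrite mxE eqxx mulr1n Re_sum_real.
  exact: lin.
- have -> : (fun s => (complex.Im (step_input p N s ord0 ord0))%:E) =
      EFin \o (fun s => \sum_(k < N) complex.Im p`_(N - k.+1) * pulse k s).
    by apply/funext => s; rewrite mxE eqxx mulr1n Im_sum_real.
  exact: lin.
Qed.

(** The integrand is a finite sum, over eigenvalues and pulses, of complex constants times real
    functions. Every pulse yields the same gain [(expR l - 1) / l] times a power of [expR l], and
    the powers add up to [p] at [expR l]. *)
Lemma ct_endpoint_eigen (n : nat) (L M : 'M[R[i]]_n) (b : 'cV[R[i]]_n)
    (l : 'I_n -> R) (p : {poly R[i]}) (N : nat) :
  L \in unitmx -> L *m M = diag_mx (\row_i (l i)%:C) *m L ->
  L *m b = const_mx 1 -> (forall i, l i != 0) -> (size p <= N)%N ->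
  ct_endpoint M b N%:R (step_input p N) =
  invmx L *m diag_mx (\row_i ((expR (l i) - 1) / l i)%:C) *m
    \col_i p.[(expR (l i))%:C].
Proof.
move=> Lu LM Lb l0 pN; apply/colP => i; rewrite mxE.
pose h (jk : 'I_n * 'I_N) s := expR ((N%:R - s) * l jk.1) * pulse jk.2 s.
pose c (jk : 'I_n * 'I_N) := invmx L i jk.1 * p`_(N - jk.2.+1).
have hint jk : mu.-integrable `[0, N%:R] (EFin \o h jk).
  apply: integrable_pulse => s.
  apply: continuous_comp; last exact: continuous_expR.
  apply: cvgM; last exact: cvg_cst.
  by apply: cvgB; [exact: cvg_cst|exact: cvg_id].
have -> : (fun s => (expmx ((N%:R - s)%:C *: M) *m b *m step_input p N s) i ord0) =
          (fun s => \sum_jk c jk * (h jk s)%:C).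
  apply/funext => s.
  have LMs : L *m ((N%:R - s)%:C *: M) =
             diag_mx (\row_i ((N%:R - s) * l i)%:C) *m L.
    rewrite -scalemxAr LM scalemxAl; congr (_ *m _).
    by apply/matrixP => j k; rewrite !mxE rmorphM mulrnAr.
  rewrite (expmx_eigen Lu LMs) -[_ *m L *m b]mulmxA Lb mul_mx_scalar mxE mulrC.
  rewrite -mulmxA mxE mulr_suml -(pair_bigA _ (fun j k => c (j, k) * (h (j, k) s)%:C)).
  apply: eq_bigr => j _; rewrite mul_diag_mx !mxE mulr1 mulr_sumr /=.
  apply: eq_bigr => k _; rewrite /c /h /= rmorphM.
  by rewrite -!mulrA; congr (_ * _); rewrite mulrCA.
rewrite (cintegral_lincomb _ c hint).
rewrite -(pair_bigA _ (fun j k => c (j, k) * (Rintegral mu `[0, N%:R] (h (j, k)))%:C)).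
rewrite -mulmxA mxE; apply: eq_bigr => j _.
(* The polynomial is padded to [N] coefficients, and the pulses are renumbered backwards to match
   the degrees. *)
rewrite mul_diag_mx !mxE (horner_coef_wide _ pN) (reindex_inj rev_ord_inj) /=.
rewrite !mulr_sumr; apply: eq_bigr => k _.
have kN := ltn_ord k.
rewrite /h /c /= Rintegral_exp_pulse //; last by lia.
have -> : (N - (N - k.+1).+1)%N = k by lia.
rewrite rmorphM rmorphXn.
by rewrite -!mulrA; congr (_ * _); rewrite mulrCA.
Qed.

End ContinuousTime.

(** * Choice of the spectrum *)

Section Spectrum.
Context {R : realType}.

Lemma within_continuous_comp {U V : topologicalType} (P : set R[i])
    (f : R[i] -> U) (h : U -> V) :
  {within P, continuous f} -> (forall z, P z -> {for f z, continuous h}) ->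
  {within P, continuous (fun z => h (f z))}.
Proof.
move=> /subspace_continuousP fC hC; apply/subspace_continuousP => z Pz B hB.
exact: (fC z Pz _ (hC z Pz B hB)).
Qed.

(** The gain of a unit pulse at the eigenvalue [ln y]. It is not simplified to [(y - 1) / ln y], so
    that it agrees by computation with the factor in [ct_endpoint_eigen]. *)
Definition step_gain (y : R) : R := (expR (ln y) - 1) / ln y.

(** Here the lower bound 2 on the nodes enters: it keeps the eigenvalues [ln y] away from 0. *)
Lemma ln_ge2_neq0 (y : R) : 2 <= y -> ln y != 0.
Proof. by move=> y2; rewrite gt_eqF // ln_gt0 //; lra. Qed.

Lemma step_gain_neq0 (y : R) : 2 <= y -> step_gain y != 0.
Proof.
move=> y2; rewrite /step_gain mulf_neq0 ?invr_eq0 ?ln_ge2_neq0 //.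
by rewrite lnK ?posrE; lra.
Qed.

Lemma continuous_step_gain (y : R) : 2 <= y -> {for y, continuous step_gain}.
Proof.
move=> y2; have lnC : {for y, continuous (@ln R)} by apply: continuous_ln; lra.
apply: cvgM; last by apply: cvgV => //; exact: ln_ge2_neq0.
apply: cvgB; last exact: cvg_cst.
exact: (continuous_comp lnC (@continuous_expR R _)).
Qed.

End Spectrum.

Theorem mainTheorem2 (R : realType) (n : nat) (P : set R[i])
    (A : R[i] -> 'M[R[i]]_n) (b : R[i] -> 'cV[R[i]]_n) :
  jordan_arc P ->
  {within P, continuous A} ->
  {within P, continuous b} ->
  (forall th, P th -> kalman_reachable (A th) (b th)) ->
  (exists F : R[i] -> 'rV[R[i]]_n, {within P, continuous F} /\
     ct_uniformly_ensemble_reachable P (fun th => A th + b th *m F th) b) /\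
  (exists F : R[i] -> 'rV[R[i]]_n, {within P, continuous F} /\
     dt_uniformly_ensemble_reachable P (fun th => A th + b th *m F th) b).
Proof.
move=> /jordan_arc_param[a [c [g [tau [ac gC tauC Pg tauP]]]]] AC bC reach.
pose mu (i : 'I_n) (z : R[i]) : R := node a c i (tau z).
have muC i : {within P, continuous (mu i)}.
  by apply: (within_continuous_comp tauC) => z _; exact: continuous_node.
have mu2 i z : P z -> 2 <= mu i z.
  by move=> /tauP[/andP[az _] _]; exact: node_ge2.
have muinj z : P z -> injective (mu^~ z).
  by move=> Pz i j /(node_inj ac) /val_inj.
have krylov_unit z : P z -> krylov (A z) (b z) \in unitmx.
  by move=> Pz; exact: kalman_krylov (reach z Pz).
split.
(* Continuous time: the eigenvalues are logarithms, so that their exponentials are the nodes. *)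
- pose l (i : 'I_n) z : R := ln (mu i z).
  have lC i : {within P, continuous (fun z => (l i z)%:C)}.
    apply: (within_continuous_comp (f := l i) (h := real_complex R)); last first.
      by move=> z _; exact: continuous_real_complex.
    apply: (within_continuous_comp (muC i)) => z Pz; apply: continuous_ln.
    by have := mu2 i z Pz; lra.
  have linj z : P z -> injective (fun i => (l i z)%:C).
    move=> Pz i j /complexI lij; apply: (muinj z Pz).
    by apply: ln_inj lij; rewrite posrE; have := mu2; move=> /(_ _ z Pz) m2;
       [have := m2 i|have := m2 j]; lra.
  pose L z := left_eigenmx (A z) (b z) (fun i => (l i z)%:C).
  have Lu z : P z -> L z \in unitmx.
    by move=> Pz; exact: left_eigenmx_unit (krylov_unit z Pz) (linj z Pz).
  exists (fun z => placing_feedback (A z) (b z) (fun i => (l i z)%:C)); split.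
    exact: (within_continuous_placing_feedback (l := fun i z => (l i z)%:C)).
  move=> f fC e e0.
  pose G z : 'M[R[i]]_n := diag_mx (\row_i (step_gain (mu i z))%:C).
  (* The invertible diagonal of gains is absorbed into the matrix to which the approximation is
     applied. *)
  pose V z := invmx (L z) *m G z.
  have Vu z : P z -> V z \in unitmx.
    move=> Pz; rewrite unitmx_mul unitmx_inv Lu //= unitmxE det_diag unitfE.
    apply/prodf_neq0 => i _; rewrite mxE.
    by rewrite (inj_eq (@complexI R) _ 0) step_gain_neq0 // mu2.
  have VC : {within P, continuous V}.
    have LC := within_continuous_inv_left_eigenmx AC bC lC reach linj.
    apply/subspace_continuousP => z Pz.
    apply: (cvg_mulmx (F := within P (nbhs z)) (f := fun z => invmx (L z))).
      exact: ((subspace_continuousP P _).1 LC z Pz).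
    apply/(cvg_mxP (F := within P (nbhs z))) => i j; rewrite !mxE.
    under eq_cvg do rewrite !mxE.
    case: (i == j); last exact: cvg_cst.
    rewrite !mulr1n.
    have gainC : {within P, continuous (fun z => (step_gain (mu i z))%:C)}.
      apply: (within_continuous_comp (f := mu i)
        (h := fun y => (step_gain y)%:C)) => // x Px.
      exact: (continuous_comp (continuous_step_gain (mu2 i x Px))
                (@continuous_real_complex R _)).
    exact: ((subspace_continuousP P _).1 gainC z Pz).
  have [p [d de pP]] := ensemble_approx ac gC Pg tauP VC fC Vu e0.
  (* One unit more than [size p] makes the final time positive even when [p = 0]. *)
  exists (size p).+1%:R, (step_input p (size p).+1); split; first by rewrite ltr0n.
  split; first exact: step_input_L1.
  exists d => // z Pz.
  rewrite (ct_endpoint_eigen (L := L z) (l := l^~ z)) //.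
  + have -> : \col_i p.[(expR (l i z))%:C] = \col_i p.[(node a c i (tau z))%:C].
      apply/colP => i; rewrite !mxE lnK // posrE.
      by have := mu2 i z Pz; rewrite /mu; lra.
    exact: pP.
  + exact: Lu.
  + exact: left_eigenmx_feedback (krylov_unit z Pz).
  + exact: left_eigenmx_b (krylov_unit z Pz).
  + by move=> i; apply: ln_ge2_neq0; exact: mu2.
(* Discrete time: the eigenvalues are the nodes themselves, and the inverse of [L z] alone serves as
   the matrix in the approximation. *)
- pose l (i : 'I_n) z : R[i] := (mu i z)%:C.
  have lC i : {within P, continuous (l i)}.
    apply: (within_continuous_comp (muC i)) => z _.
    exact: continuous_real_complex.
  have linj z : P z -> injective (l^~ z).
    by move=> Pz i j /complexI /(muinj z Pz).
  pose L z := left_eigenmx (A z) (b z) (l^~ z).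
  have Lu z : P z -> L z \in unitmx.
    by move=> Pz; exact: left_eigenmx_unit (krylov_unit z Pz) (linj z Pz).
  exists (fun z => placing_feedback (A z) (b z) (l^~ z)); split.
    exact: within_continuous_placing_feedback.
  move=> f fC e e0.
  have VC := within_continuous_inv_left_eigenmx AC bC lC reach linj.
  have Vu z : P z -> invmx (L z) \in unitmx.
    by move=> Pz; rewrite unitmx_inv Lu.
  have [p [d de pP]] := ensemble_approx ac gC Pg tauP VC fC Vu e0.
  exists (size p), (fun k => (p`_((size p).-1 - k))%:M); exists d => // z Pz.
  rewrite (dt_endpoint_eigen (L := L z) (l := l^~ z)).
  + exact: pP.
  + exact: Lu.
  + exact: left_eigenmx_feedback (krylov_unit z Pz).
  + exact: left_eigenmx_b (krylov_unit z Pz).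
Qed.
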